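(* Suppose that for infinitely many integers $n\geq 2$ there exists a division ring extension $G\subseteq F$ such that the $(G,F)$-bimodule $F$ has the right dimension sequence $(1,\underbrace{2,\dots,2}_{(n-1)\times},1,n)$ of length $n+2$ (that is, its right dimension sequence is periodic and this is a period of length $n+2$). Then there exists a squared small counterexample to the pure semisimplicity conjecture; that is, there exists a division ring extension $G\subseteq F$ such that the $(G,F)$-bimodule $F$ has the right dimension sequence $(1,2,2,2,\dots)$ (all terms after the first equal to $2$) and $\dim {}_GF=\infty$.
   Context: Rings are associative and unital; ring embeddings and extensions are unital. For division rings $G,F$ and a $(G,F)$-bimodule $M$, the right dual of $M$ is the $(F,G)$-bimodule $M^r=\operatorname{Hom}_F(M_F,F_F)$ with $(f\varphi g)(m)=f\varphi(gm)$; then $M^{rr}=\operatorname{Hom}_G((M^r)_G,G_G)$ is a $(G,F)$-bimodule, and so on. The right dimension sequence of $M$ is the sequence $(\dim M_F,\dim (M^r)_G,\dim (M^{rr})_F,\dots)$. If this sequence is periodic, one often writes only a finite period, specifying its length if necessary. For a division ring extension $G\subseteq F$, $F$ is regarded as a $(G,F)$-bimodule by multiplication. The triangular matrix ring $R_F=\begin{pmatrix} G & F\\ 0& F\end{pmatrix}$ is called a squared small counterexample to the pure semisimplicity conjecture if the right dimension sequence of the $(G,F)$-bimodule $F$ is $(1,2,2,2,\dots)$ and $\dim {}_GF=\infty$. *)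

(* Defs.v *)
From HB Require Import structures.
From mathcomp Require Import all_boot all_order all_algebra.
From mathcomp Require Import all_classical.

Set Implicit Arguments.
Unset Strict Implicit.
Unset Printing Implicit Defensive.

Import GRing.Theory.
Local Open Scope ring_scope.

(* GRing.field_axiom does not assume commutativity: every nonzero element
   is invertible. *)
Definition division_ring (R : unitRingType) : Prop := GRing.field_axiom R.

HB.mixin Record Lmodule_isBimodule (G F : nzRingType) V
    of GRing.Lmodule G V := {
  ract : V -> F -> V;
  ractA : forall (x : V) (a b : F), ract (ract x a) b = ract x (a * b);
  ract1 : forall x : V, ract x 1 = x;
  ractDl : forall (x y : V) (a : F), ract (x + y) a = ract x a + ract y a;
  ractDr : forall (x : V) (a b : F), ract x (a + b) = ract x a + ract x b;
  ract_scale : forall (g : G) (x : V) (a : F), ract (g *: x) a = g *: ract x a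
}.

#[short(type="bimodType")]
HB.structure Definition Bimodule (G F : nzRingType) :=
  { V of GRing.Lmodule G V & Lmodule_isBimodule G F V }.

Arguments ract {G F s}.

Section RightDual.
Variables (G F : nzRingType) (M : bimodType G F).

Definition right_linear : {pred M -> F} :=
  fun phi => `[< (forall x y : M, phi (x + y) = phi x + phi y) /\
                 (forall (x : M) (a : F), phi (ract x a) = phi x * a) >].

Lemma right_linearP (phi : M -> F) :
  reflect ((forall x y : M, phi (x + y) = phi x + phi y) /\
           (forall (x : M) (a : F), phi (ract x a) = phi x * a))
          (phi \in right_linear).
Proof. exact: asboolP. Qed.

Lemma right_linear_zmod_closed : zmod_closed right_linear.
Proof.
split; first by apply/right_linearP; split=> *; rewrite ?addr0 ?mul0r.
move=> u v /right_linearP[uD uZ] /right_linearP[vD vZ].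
apply/right_linearP; split=> [x y|x a].
  by rewrite !fctE uD vD opprD addrACA.
by rewrite !fctE uZ vZ mulrBl.
Qed.

HB.instance Definition _ :=
  GRing.isZmodClosed.Build (M -> F) right_linear right_linear_zmod_closed.

Record rdual := RDual {
  rdual_fun :> M -> F;
  rdual_linear : rdual_fun \in right_linear
}.

HB.instance Definition _ := [isSub for rdual_fun].
HB.instance Definition _ := [Choice of rdual by <:].
HB.instance Definition _ := [SubChoice_isSubZmodule of rdual by <:].

Lemma rdualD (phi : rdual) (x y : M) : phi (x + y) = phi x + phi y.
Proof. by case: phi => f /= /right_linearP[]. Qed.

Lemma rdualZ (phi : rdual) (x : M) (a : F) : phi (ract x a) = phi x * a.
Proof. by case: phi => f /= /right_linearP[]. Qed.

Lemma rdualP (phi psi : rdual) : (forall x, phi x = psi x) -> phi = psi.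
Proof. by move=> e; apply/val_inj/funext. Qed.

Lemma rdual_addE (phi psi : rdual) (x : M) : (phi + psi) x = phi x + psi x.
Proof. by []. Qed.

Lemma rdual_scale_subproof (f : F) (phi : rdual) :
  (fun m : M => f * phi m) \in right_linear.
Proof.
by apply/right_linearP; split=> *; rewrite ?rdualD ?rdualZ ?mulrDr ?mulrA.
Qed.

Lemma rdual_ract_subproof (phi : rdual) (g : G) :
  (fun m : M => phi (g *: m)) \in right_linear.
Proof.
by apply/right_linearP; split=> *; rewrite ?scalerDr ?rdualD -?ract_scale ?rdualZ.
Qed.

Definition rdual_scale (f : F) (phi : rdual) : rdual :=
  RDual (rdual_scale_subproof f phi).

Definition rdual_ract (phi : rdual) (g : G) : rdual :=
  RDual (rdual_ract_subproof phi g).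

Fact rdual_scaleA a b phi :
  rdual_scale a (rdual_scale b phi) = rdual_scale (a * b) phi.
Proof. by apply: rdualP => x /=; rewrite mulrA. Qed.

Fact rdual_scale1 : left_id 1 rdual_scale.
Proof. by move=> phi; apply: rdualP => x /=; rewrite mul1r. Qed.

Fact rdual_scaleDr : right_distributive rdual_scale +%R.
Proof. by move=> a phi psi; apply: rdualP => x; rewrite /= mulrDr. Qed.

Fact rdual_scaleDl phi : {morph rdual_scale^~ phi : a b / a + b}.
Proof. by move=> a b; apply: rdualP => x; rewrite /= mulrDl. Qed.

HB.instance Definition _ := GRing.Zmodule_isLmodule.Build F rdual
  rdual_scaleA rdual_scale1 rdual_scaleDr rdual_scaleDl.

Fact rdual_ractA phi a b :
  rdual_ract (rdual_ract phi a) b = rdual_ract phi (a * b).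
Proof. by apply: rdualP => x /=; rewrite scalerA. Qed.

Fact rdual_ract1 phi : rdual_ract phi 1 = phi.
Proof. by apply: rdualP => x /=; rewrite scale1r. Qed.

Fact rdual_ractDl phi psi a :
  rdual_ract (phi + psi) a = rdual_ract phi a + rdual_ract psi a.
Proof. exact: rdualP. Qed.

Fact rdual_ractDr phi a b :
  rdual_ract phi (a + b) = rdual_ract phi a + rdual_ract phi b.
Proof. by apply: rdualP => x; rewrite /= scalerDl rdualD. Qed.

Fact rdual_ract_scale (f : F) phi a :
  rdual_ract (f *: phi) a = f *: rdual_ract phi a.
Proof. exact: rdualP. Qed.

HB.instance Definition _ := Lmodule_isBimodule.Build F G rdual
  rdual_ractA rdual_ract1 rdual_ractDl rdual_ractDr rdual_ract_scale.

End RightDual.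

Definition has_rdim (G F : nzRingType) (M : bimodType G F) (d : nat) : Prop :=
  exists e : 'I_d -> M,
    (forall c : 'I_d -> F, \sum_i ract (e i) (c i) = 0 -> forall i, c i = 0) /\
    (forall x : M, exists c : 'I_d -> F, x = \sum_i ract (e i) (c i)).

Definition has_ldim (G : nzRingType) (V : lmodType G) (d : nat) : Prop :=
  exists e : 'I_d -> V,
    (forall c : 'I_d -> G, \sum_i c i *: e i = 0 -> forall i, c i = 0) /\
    (forall x : V, exists c : 'I_d -> G, x = \sum_i c i *: e i).

Definition infinite_ldim (G : nzRingType) (V : lmodType G) : Prop :=
  forall d : nat, ~ has_ldim V d.

(* The term of index k is the right dimension of the k-fold right dual of M,
   which is a (G, F)-bimodule for even k and an (F, G)-bimodule for odd k. *)
Fixpoint has_rdim_term (k : nat) (G F : nzRingType) (M : bimodType G F)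
    (d : nat) {struct k} : Prop :=
  if k is k'.+1 then has_rdim_term k' (rdual M) d else has_rdim M d.

Definition has_rdim_seq (G F : nzRingType) (M : bimodType G F)
    (s : nat -> nat) : Prop :=
  forall k : nat, has_rdim_term k M (s k).

Definition periodic_seq (p : seq nat) : nat -> nat :=
  fun k => nth 0%N p (k %% size p).

(* The carrier F regarded as a (G, F)-bimodule along iota : G -> F. *)
Definition ext_bimod (G F : nzRingType) (iota : {rmorphism G -> F}) : Type := F.

Section ExtBimod.
Variables (G F : nzRingType) (iota : {rmorphism G -> F}).
Local Notation E := (ext_bimod iota).

HB.instance Definition _ := GRing.Zmodule.on E.

Definition ext_scale (g : G) (x : E) : E := iota g * (x : F).
Definition ext_ract (x : E) (f : F) : E := (x : F) * f.

Fact ext_scaleA a b x : ext_scale a (ext_scale b x) = ext_scale (a * b) x.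
Proof. by rewrite /ext_scale rmorphM mulrA. Qed.

Fact ext_scale1 : left_id 1 ext_scale.
Proof. by move=> x; rewrite /ext_scale rmorph1 mul1r. Qed.

Fact ext_scaleDr : right_distributive ext_scale +%R.
Proof. by move=> a x y; exact: mulrDr. Qed.

Fact ext_scaleDl x : {morph ext_scale^~ x : a b / a + b}.
Proof. by move=> a b; rewrite /ext_scale rmorphD mulrDl. Qed.

HB.instance Definition _ := GRing.Zmodule_isLmodule.Build G E
  ext_scaleA ext_scale1 ext_scaleDr ext_scaleDl.

Fact ext_ractA x a b : ext_ract (ext_ract x a) b = ext_ract x (a * b).
Proof. by rewrite /ext_ract mulrA. Qed.

Fact ext_ract1 x : ext_ract x 1 = x.
Proof. exact: mulr1. Qed.

Fact ext_ractDl x y a : ext_ract (x + y) a = ext_ract x a + ext_ract y a.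
Proof. exact: mulrDl. Qed.

Fact ext_ractDr x a b : ext_ract x (a + b) = ext_ract x a + ext_ract x b.
Proof. exact: mulrDr. Qed.

Fact ext_ract_scale (g : G) (x : E) a : ext_ract (g *: x) a = g *: ext_ract x a.
Proof. by rewrite /ext_ract -mulrA. Qed.

HB.instance Definition _ := Lmodule_isBimodule.Build G F E
  ext_ractA ext_ract1 ext_ractDl ext_ractDr ext_ract_scale.

End ExtBimod.

(* G is identified with its image under the injective morphism iota. *)
Definition division_ring_extension (G F : unitRingType)
    (iota : {rmorphism G -> F}) : Prop :=
  [/\ division_ring G, division_ring F & injective iota].

Definition squared_small_counterexample (G F : unitRingType)
    (iota : {rmorphism G -> F}) : Prop :=
  [/\ division_ring_extension iota,
      has_rdim_seq (ext_bimod iota) (fun k => if k == 0%N then 1%N else 2%N)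
    & infinite_ldim (ext_bimod iota)].

(* Main.v *)
Require Import Defs.
From HB Require Import structures.
From mathcomp Require Import all_boot all_order all_algebra.
From mathcomp Require Import all_classical.
From mathcomp Require Import zify.

(** Let [U] be a non-principal ultrafilter on indices [i] with extensions
    [G_i <= F_i] whose right dimension sequences start with [1, 2, ..., 2]
    (at least [i] terms).  Ultraproducts commute with the right dual of
    bimodules of fixed finite right dimension, so the ultraproduct
    [G <= F] has the right dimension sequence [(1, 2, 2, ...)].

    This sequence already forces [dim _G F] to be infinite.  Choose nonzero
    [phi_j] in the [j]-th right dual [M_j] of [F] with [phi_(j+1) phi_j = 0].
    A matrix [Z] over [M_j] is nondegenerate if no nonzero row [g] makes
    [phi_(j+1)] vanish on [g Z].  Its rows are then independent functionals,
    and a basis of their common kernel in a power of [M_(j-1)] forms a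
    nondegenerate matrix over [M_(j-1)]; an [r x c] matrix becomes a
    [c x (e c - r)] one, where [e] is the right dimension of [M_(j-1)].
    Starting at [M_k] with a [1 x 2] matrix (a right basis), one reaches a
    [(k+1) x 1] matrix over [F], that is, [k+1] elements left independent
    over [G]. *)

Set Implicit Arguments.
Unset Strict Implicit.
Unset Printing Implicit Defensive.
Import GRing.Theory.
Local Open Scope ring_scope.

(** * Linear algebra over division rings *)

(** With a pivot [p] such that [b 0 p] is invertible, column [j] of [C] encodes the equation
    [w_i = w_p * b_p^-1 * b_i] for [i = lift p j]. These equations over all [i] other than [p] say
    that [w] lies on the left line through [b]. *)
Lemma row_complement (D : unitRingType) (s : nat) (b : 'rV[D]_s) :
  division_ring D -> b != 0 ->
  exists (s' : nat) (C : 'M[D]_(s, s')),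
    s = s'.+1 /\ forall w : 'rV_s, w *m C = 0 -> exists a : D, w = a *: b.
Proof.
move=> divD /rV0Pn[p]; case: s => [|s] in b p *; first by case: p.
move=> bp; have ub : b 0 p \is a GRing.unit by exact: divD.
pose C : 'M[D]_(s.+1, s) := \matrix_(i, j)
  (if i == p then - ((b 0 p)^-1 * b 0 (lift p j)) else (i == lift p j)%:R).
have CE (w : 'rV_s.+1) j :
    (w *m C) 0 j = w 0 (lift p j) - w 0 p * ((b 0 p)^-1 * b 0 (lift p j)).
  rewrite mxE (bigD1 p) //= (bigD1 (lift p j)) 1?eq_sym ?neq_lift //=.
  rewrite big1 => [|i /andP[ip ij]]; last by rewrite mxE (negPf ip) (negPf ij) mulr0.
  by rewrite !mxE eqxx eq_sym (negPf (neq_lift _ _)) eqxx mulr1 addr0 mulrN addrC.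
exists s, C; split=> // w wC.
exists (w 0 p * (b 0 p)^-1); apply/rowP=> j; rewrite mxE.
have [k ->|->] := unliftP p j; last by rewrite -mulrA mulVr // mulr1.
by move/rowP/(_ k): wC; rewrite CE mxE mulrA => /subr0_eq.
Qed.

(** The span of [r] independent rows is cut out by [n - r] equations, the columns of [B]. Induction
    on [r]: if [B] cuts out the span of the lower rows [A'], then [a *m B] is nonzero by
    independence, and multiplying [B] by its [row_complement] trades one equation for the extra row
    [a]. *)
Lemma row_free_complement (D : unitRingType) (r n : nat) (A : 'M[D]_(r, n)) :
  division_ring D -> (forall u : 'rV_r, u *m A = 0 -> u = 0) ->
  exists (s : nat) (B : 'M[D]_(n, s)),
    (r + s)%N = n /\ forall w : 'rV_n, w *m B = 0 -> exists u : 'rV_r, w = u *m A.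
Proof.
move=> divD; elim: r => [|r IH] in A * => freeA.
  exists n, 1%:M; split=> // w; rewrite mulmx1 => ->.
  by exists 0; rewrite mul0mx.
have [a [A' defA]] : exists (a : 'rV_n) (A' : 'M_(r, n)), A = col_mx a A'.
  by exists (@usubmx _ 1 r n A), (@dsubmx _ 1 r n A); rewrite vsubmxK.
have freeaA (x : 'rV_1) (u : 'rV_r) : x *m a + u *m A' = 0 -> x = 0 /\ u = 0.
  rewrite -mul_row_col -defA => /freeA xu.
  have xu0 : row_mx x u == 0 by apply/eqP.
  by split; apply/eqP; move: xu0; rewrite row_mx_eq0 => /andP[].
have [u uA|s [B [rs BP]]] := IH A'.
  by have [|//] := freeaA 0 u; rewrite mul0mx add0r.
have aB : a *m B != 0.
  apply/eqP => /BP[u au].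
  have [|/matrixP/(_ 0 0)/eqP] := freeaA 1 (- u).
    by rewrite mul1mx mulNmx au subrr.
  by rewrite !mxE oner_eq0.
have [s' [C [es CP]]] := row_complement divD aB.
exists s', (B *m C); split=> [|w]; first by rewrite addSn -rs es addnS.
rewrite mulmxA => /CP[x wB].
(* Since [w *m B] is a left multiple of [a *m B], subtracting that multiple of [a] from [w] leaves a
   vector in the span of [A']. *)
have /BP[u wu] : (w - x *: a) *m B = 0 by rewrite mulmxBl -scalemxAl wB subrr.
have -> : w = row_mx x%:M u *m col_mx a A'.
  by rewrite mul_row_col mul_scalar_mx -wu addrC subrK.
by exists (row_mx x%:M u); rewrite defA.
Qed.

(** * Right bases and the functionals they determine *)

Section RightBasis.
Variables (G F : nzRingType) (M : bimodType G F).

Lemma ract0 (x : M) : ract x (0 : F) = 0.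
Proof. by apply: (addrI (ract x 0)); rewrite -ractDr !addr0. Qed.

Lemma ract0l (a : F) : ract (0 : M) a = 0.
Proof. by apply: (addrI (ract 0 a)); rewrite -ractDl !addr0. Qed.

Lemma ract_suml (I : Type) (s : seq I) (P : pred I) (x : I -> M) (a : F) :
  ract (\sum_(i <- s | P i) x i) a = \sum_(i <- s | P i) ract (x i) a.
Proof. by apply: (big_morph (ract^~ a)) => [x' y|]; rewrite ?ractDl ?ract0l. Qed.

Lemma rdual0 (phi : rdual M) : phi 0 = 0.
Proof. by apply: (addrI (phi 0)); rewrite -rdualD !addr0. Qed.

Lemma rdual_sum (phi : rdual M) (I : Type) (s : seq I) (P : pred I) (x : I -> M) :
  phi (\sum_(i <- s | P i) x i) = \sum_(i <- s | P i) phi (x i).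
Proof. by apply: (big_morph phi) => [x' y|]; rewrite ?rdualD ?rdual0. Qed.

Lemma rdual_sumE (I : Type) (s : seq I) (P : pred I) (phi : I -> rdual M) (x : M) :
  (\sum_(i <- s | P i) phi i) x = \sum_(i <- s | P i) phi i x.
Proof. by apply: (big_morph (fun psi : rdual M => psi x)). Qed.

(** The body of [has_rdim] for a given family, so that a basis can be chosen and transported. *)
Definition right_basis (d : nat) (e : 'I_d -> M) : Prop :=
  (forall c : 'I_d -> F, \sum_i ract (e i) (c i) = 0 -> forall i, c i = 0) /\
  (forall x : M, exists c : 'I_d -> F, x = \sum_i ract (e i) (c i)).

Variables (d : nat) (e : 'I_d -> M).
Hypothesis e_basis : right_basis e.

Lemma right_basis_rdual_inj (phi psi : rdual M) :
  (forall i, phi (e i) = psi (e i)) -> phi = psi.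
Proof.
move=> phi_psi; apply: rdualP => x; have [c ->] := e_basis.2 x.
by rewrite !rdual_sum; apply: eq_bigr => i _; rewrite !rdualZ phi_psi.
Qed.

Lemma right_basis_coord_inj (c c' : 'I_d -> F) :
  \sum_i ract (e i) (c i) = \sum_i ract (e i) (c' i) -> c =1 c'.
Proof.
move=> cc' i; apply: subr0_eq; apply: (e_basis.1 (fun j => c j - c' j)).
rewrite (eq_bigr (fun j => ract (e j) (c j) - ract (e j) (c' j))).
  by rewrite big_split sumrN /= cc' subrr.
move=> j _; apply: (addIr (ract (e j) (c' j))).
by rewrite -ractDr !subrK.
Qed.

(** Coordinates are chosen for every vector; their uniqueness makes them additive and right
    homogeneous, so left multiplication by the prescribed values [a] gives a right linear map. *)
Lemma right_basis_rdual_ex (a : 'I_d -> F) :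
  exists phi : rdual M, forall i, phi (e i) = a i.
Proof.
have [c cP] := choice e_basis.2.
have lin : (fun x => \sum_i a i * c x i) \in @right_linear G F M.
  apply/right_linearP; split=> [x y|x b].
    rewrite -big_split /=; apply: eq_bigr => i _; rewrite -mulrDr; congr (_ * _).
    move: i; apply: right_basis_coord_inj; rewrite -cP [in LHS](cP x) [in LHS](cP y).
    by rewrite -big_split /=; apply: eq_bigr => i _; rewrite ractDr.
  rewrite mulr_suml; apply: eq_bigr => i _; rewrite -mulrA; congr (_ * _).
  move: i; apply: right_basis_coord_inj; rewrite -cP [in LHS](cP x) ract_suml.
  by apply: eq_bigr => i _; rewrite ractA.
exists (RDual lin) => i /=.
have -> : \sum_j a j * c (e i) j = \sum_j a j * (i == j)%:R.
  apply: eq_bigr => j _; congr (_ * _).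
  move: j; apply: right_basis_coord_inj; rewrite -cP (bigD1 i) //= eqxx ract1.
  by rewrite big1 ?addr0 // => j; rewrite eq_sym => /negPf->; rewrite ract0.
rewrite (bigD1 i) //= eqxx mulr1 big1 ?addr0 // => j.
by rewrite eq_sym => /negPf->; rewrite mulr0.
Qed.

End RightBasis.

(** * Infinite left dimension *)

Definition nondegenerate_matrix (G F : nzRingType) (M : bimodType G F)
    (phi : rdual M) (r c : nat) (Z : 'I_r -> 'I_c -> M) : Prop :=
  forall g : 'I_r -> G,
    (forall l, phi (\sum_i g i *: Z i l) = 0) -> forall i, g i = 0.

Lemma rdual_ract_eq0 (G : unitRingType) (F : nzRingType) (M : bimodType G F)
    (phi : rdual M) (g : G) :
  division_ring G -> phi != 0 -> rdual_ract phi g = 0 -> g = 0.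
Proof.
move=> divG phi0 phig; apply/eqP; apply: contraNT phi0 => /divG gU.
apply/eqP/rdualP => x.
have := congr1 (fun chi : rdual M => chi (g^-1 *: x)) phig.
by rewrite /= scalerA divrr // scale1r.
Qed.

(** Row [i] of [Z] is a functional on [M^c], sending [x] to the sum of the [Z i l (x_l)].
    Nondegeneracy makes these [r] functionals independent, so there are [s = c * e - r] vectors in
    [M^c] such that every functional vanishing on all of them is a combination of the rows. These
    vectors are the columns of [Z']. *)
Lemma nondegenerate_matrix_step (G F : unitRingType) (M : bimodType G F)
    (phi : rdual M) (psi : rdual (rdual M)) (e r c : nat)
    (Z : 'I_r -> 'I_c -> rdual M) :
  division_ring G -> division_ring F -> has_rdim M e ->
  phi != 0 -> psi phi = 0 -> nondegenerate_matrix psi Z ->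
  exists (s : nat) (Z' : 'I_c -> 'I_s -> M),
    (r + s = c * e)%N /\ nondegenerate_matrix phi Z'.
Proof.
move=> divG divF [b bP] phi0 psi_phi ndZ.
(* Coordinates of the row functionals in the basis of [M^c] given by [b k] in slot [l]; [mxvec]
   flattens the pair [(l, k)]. *)
pose A := \matrix_(i < r) mxvec (\matrix_(l < c, k < e) Z i l (b k)).
have uA (u : 'rV_r) l k :
    (u *m A) 0 (mxvec_index l k) = (\sum_i u 0 i *: Z i l) (b k).
  rewrite mxE rdual_sumE; apply: eq_bigr => i _.
  by rewrite mxE mxvecE mxE.
have freeA (u : 'rV_r) : u *m A = 0 -> u = 0.
  move=> uA0; apply/rowP=> i; rewrite [RHS]mxE.
  apply: (ndZ (fun j => u 0 j)) => l; rewrite -[RHS](rdual0 psi); congr (psi _).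
  by apply: (right_basis_rdual_inj bP) => k; rewrite -uA uA0 mxE.
have [s [B [rs BP]]] := row_free_complement divF freeA.
exists s, (fun l m => \sum_k ract (b k) (B (mxvec_index l k) m)); split=> // h h0.
(* Coordinates of the functional sending [x] to [phi] of the sum of the [h l *: x_l]; by [h0] it
   vanishes on the columns of [Z']. *)
pose w := mxvec (\matrix_(l < c, k < e) phi (h l *: b k)).
have [u wu] : exists u : 'rV_r, w = u *m A.
  apply: BP; apply/rowP=> m; rewrite [RHS]mxE -[RHS](h0 m) rdual_sum.
  transitivity (\sum_l \sum_k w 0 (mxvec_index l k) * B (mxvec_index l k) m).
    rewrite pair_bigA mxE (reindex _ (curry_mxvec_bij c e)) /=.
    by apply: eq_bigr => -[l k].
  apply: eq_bigr => l _ /=; rewrite scaler_sumr rdual_sum; apply: eq_bigr => k _.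
  by rewrite mxvecE mxE -ract_scale rdualZ.
(* [phi h_l] vanishes on the common kernel of the rows of [Z], so it is a
   combination of the [Z i l], to which [psi] applies. *)
have phih l : rdual_ract phi (h l) = \sum_i u 0 i *: Z i l.
  by apply: (right_basis_rdual_inj bP) => k; rewrite -uA -wu mxvecE mxE.
(* Right linearity gives [psi (phi h_l) = psi phi * h_l = 0], so nondegeneracy of [Z] forces
   [u = 0]. Every [phi h_l] then vanishes, and so does [h_l] because [phi] is nonzero. *)
have u0 : u = 0.
  apply/rowP=> i; rewrite [RHS]mxE; apply: (ndZ (fun j => u 0 j)) => l.
  by rewrite -phih -[rdual_ract _ _]/(ract phi (h l)) rdualZ psi_phi mul0r.
move=> l; apply: (rdual_ract_eq0 divG phi0); rewrite phih big1 // => i _.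
by rewrite u0 mxE scale0r.
Qed.

(** In dimension at least 2 the coordinate column of [x] is killed by some nonzero row. This
    supplies each [phi_(j+1)] with [phi_(j+1) phi_j = 0]. *)
Lemma rdual_annihilator_ex (G F : unitRingType) (M : bimodType G F) (d : nat) (x : M) :
  division_ring F -> has_rdim M d.+2 ->
  exists2 psi : rdual M, psi != 0 & psi x = 0.
Proof.
move=> divF [e eP]; have [c ->] := eP.2 x.
suff [w [w0 wc]] : exists w : 'I_d.+2 -> F, (exists i, w i != 0) /\ \sum_i w i * c i = 0.
  have [psi psiP] := right_basis_rdual_ex eP w.
  exists psi; last by rewrite rdual_sum -[RHS]wc; apply: eq_bigr => i _; rewrite rdualZ psiP.
  by case: w0 => i; apply: contraNneq => psi0; rewrite -psiP psi0.
pose i1 : 'I_d.+2 := lift ord0 ord0.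
have [c0|c0] := eqVneq (c ord0) 0.
  exists (fun i => (i == ord0)%:R); split; first by exists ord0; rewrite oner_eq0.
  rewrite (bigD1 ord0) //= c0 mulr0 add0r big1 // => i /negPf->.
  by rewrite mul0r.
have {}c0 : c ord0 \is a GRing.unit by exact: divF.
(* The row [(- c_1 * c_0^-1, 1, 0, ..., 0)], available because [c_0] is invertible. *)
exists (fun i => if i == ord0 then - c i1 * (c ord0)^-1 else (i == i1)%:R); split.
  by exists i1; rewrite oner_eq0.
rewrite (bigD1 ord0) //= (bigD1 i1) //= mulrVK // mul1r big1 ?addr0 ?addNr //.
by move=> i /andP[/negPf-> /negPf->]; rewrite mul0r.
Qed.

(** Induction on [k] over all bimodules, because the hypothesis is applied to [rdual M], where the
    two division rings change places. For [k = 0] the single row is a right basis of [M]. *)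
Lemma nondegenerate_matrix_ex (k : nat) (G F : unitRingType) (M : bimodType G F)
    (phi : rdual M) :
  division_ring G -> division_ring F ->
  (forall j, (j <= k)%N -> has_rdim_term j M 2) -> phi != 0 ->
  exists Z : 'I_k.+1 -> 'I_k.+2 -> M, nondegenerate_matrix phi Z.
Proof.
elim: k => [|k IH] in G F M phi * => divG divF dimM phi0.
  have [e eP] := dimM 0%N isT.
  exists (fun _ => e) => g g0 i; rewrite ord1.
  apply: (rdual_ract_eq0 divG phi0); apply: (right_basis_rdual_inj eP) => l.
  by rewrite /= -[RHS](g0 l) big_ord1.
have dim0 : has_rdim M 2 := dimM 0%N isT.
have dim1 : has_rdim (rdual M) 2 := dimM 1%N isT.
have [psi psi0 psi_phi] := rdual_annihilator_ex phi divG dim1.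
have [|Z ndZ] := IH _ _ (rdual M) psi divF divG _ psi0.
  by move=> j; exact: (dimM j.+1).
have [s [Z' [ks ndZ']]] := nondegenerate_matrix_step divG divF dim0 phi0 psi_phi ndZ.
(* A [(k+1) x (k+2)] matrix over the dual has [s = 2 * (k+2) - (k+1) = k+3]. *)
have es : s = k.+3 by lia.
by rewrite es in Z' ndZ' *; exists Z'.
Qed.

(** The coordinate rows of the [z l] are independent in [D^d] for [D = G], and [row_free_complement]
    then writes [d] as [r + s]. *)
Lemma ldim_free_leq (G : unitRingType) (V : lmodType G) (d r : nat) (z : 'I_r -> V) :
  division_ring G -> has_ldim V d ->
  (forall g : 'I_r -> G, \sum_i g i *: z i = 0 -> forall i, g i = 0) -> (r <= d)%N.
Proof.
move=> divG [e [_ e_span]] free_z; have [c cP] := choice (fun l => e_span (z l)).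
pose A := \matrix_(l < r, i < d) c l i.
have [|s [_ [ds _]]] := row_free_complement (A := A) divG; last by lia.
move=> u uA; apply/rowP=> l; rewrite [RHS]mxE.
apply: (free_z (fun l => u 0 l)); under eq_bigr do rewrite cP scaler_sumr.
rewrite exchange_big big1 // => i _; under eq_bigr do rewrite scalerA.
rewrite -scaler_suml; move/rowP/(_ i): uA; rewrite !mxE => uA.
rewrite [X in X *: _](_ : _ = 0) ?scale0r // -[RHS]uA.
by apply: eq_bigr => j _; rewrite mxE.
Qed.

Lemma infinite_ldim_of_rdim_1222 (G F : unitRingType) (iota : {rmorphism G -> F}) :
  division_ring G -> division_ring F ->
  has_rdim_seq (ext_bimod iota) (fun k => if k == 0%N then 1%N else 2%N) ->
  infinite_ldim (ext_bimod iota).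
Proof.
move=> divG divF dimF d dim_d; pose M := ext_bimod iota.
have lin : (idfun : M -> F) \in @right_linear G F M.
  by apply/right_linearP; split.
(* The chain of functionals starts from the identity of [F], so for a one-column matrix
   nondegeneracy is left independence of its entries. *)
pose phi : rdual M := RDual lin.
have phi0 : phi != 0.
  apply: contraTneq (oner_neq0 F) => phi0; rewrite negbK; apply/eqP.
  exact: (congr1 (fun chi : rdual M => chi 1) phi0).
have [psi psi0 psi_phi] := rdual_annihilator_ex phi divG (dimF 1%N).
have [|Z ndZ] := nondegenerate_matrix_ex (k := d) divF divG _ psi0.
  by move=> j _; exact: (dimF j.+1).
have [s [Z' [ds ndZ']]] :=
  nondegenerate_matrix_step divG divF (dimF 0%N : has_rdim M 1) phi0 psi_phi ndZ.
(* As [F] has right dimension 1, the last step gives [s = (d+2) - (d+1) = 1]: one column of [d+2]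
   left independent elements, too many for left dimension [d]. *)
have es : s = 1%N by lia.
rewrite {s ds}es in Z' ndZ'.
have : (d.+2 <= d)%N; last by lia.
apply: (ldim_free_leq (z := fun l => Z' l ord0) divG dim_d) => g g0.
by apply: ndZ' => m; rewrite ord1.
Qed.

(** * Ultraproducts *)

Section Ultraproduct.
Local Open Scope classical_set_scope.
Variables (I : Type) (U : set_system I).

(* An ultraproduct is given by its projection [p] from the full product, so
   that every bimodule isomorphic to an ultraproduct is covered as it stands. *)
Definition ultra_quotient (X : I -> Type) (Y : Type) (p : (forall i, X i) -> Y) :=
  (forall y, exists x, p x = y) /\
  (forall x x', p x = p x' <-> U [set i | x i = x' i]).

Record ultra_ring (R : I -> nzRingType) (S : nzRingType)
    (p : (forall i, R i) -> S) : Prop := UltraRing {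
  ultra_ring_quotient : ultra_quotient p;
  ultra_ringD : forall x y, p (fun i => x i + y i) = p x + p y;
  ultra_ringM : forall x y, p (fun i => x i * y i) = p x * p y;
  ultra_ring1 : p (fun _ => 1) = 1
}.

Record ultra_bimod (G F : I -> nzRingType) (G' F' : nzRingType)
    (pG : (forall i, G i) -> G') (pF : (forall i, F i) -> F')
    (M : forall i, bimodType (G i) (F i)) (N : bimodType G' F')
    (p : (forall i, M i) -> N) : Prop := UltraBimod {
  ultra_bimod_quotient : ultra_quotient p;
  ultra_bimodD : forall x y, p (fun i => x i + y i) = p x + p y;
  ultra_bimodZ : forall g x, p (fun i => g i *: x i) = pG g *: p x;
  ultra_bimod_ract : forall x f, p (fun i => ract (x i) (f i)) = ract (p x) (pF f)
}.

Section Additive.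
Variables (X : I -> zmodType) (Y : zmodType) (p : (forall i, X i) -> Y).
Hypothesis pD : forall x y, p (fun i => x i + y i) = p x + p y.

Lemma ultra_zero : p (fun _ => 0) = 0.
Proof.
apply: (addrI (p (fun _ => 0))); rewrite -pD addr0; congr p.
by apply: functional_extensionality_dep => i; rewrite addr0.
Qed.

Lemma ultra_sum (d : nat) (x : forall i, 'I_d -> X i) :
  p (fun i => \sum_k x i k) = \sum_k p (fun i => x i k).
Proof.
elim: d x => [|d IH] x.
  rewrite big_ord0 -[RHS]ultra_zero; congr p.
  by apply: functional_extensionality_dep => i; rewrite big_ord0.
rewrite big_ord_recl -IH -pD; congr p; apply: functional_extensionality_dep => i.
by rewrite big_ord_recl.
Qed.

End Additive.

Context {UU : UltraFilter U}.

(** The dimension is a premise at each index, so that [e] is defined everywhere; where it fails, the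
    zero family is a placeholder. *)
Lemma ultra_basis_ex (G F : I -> nzRingType) (M : forall i, bimodType (G i) (F i)) (d : nat) :
  exists e : forall i, 'I_d -> M i,
    forall i, has_rdim (M i) d -> right_basis (e i).
Proof.
have He i : exists e : 'I_d -> M i, has_rdim (M i) d -> right_basis e.
  have [[e eP]|nM] := pselect (has_rdim (M i) d); first by exists e.
  by exists (fun _ => 0).
by exists (fun i => sval (cid (He i))) => i; apply: (svalP (cid (He i))).
Qed.

(** * Bases, dimensions and right duals of ultraproduct bimodules *)

Section Bimodule.
Variables (G F : I -> nzRingType) (G' F' : nzRingType).
Variables (pG : (forall i, G i) -> G') (pF : (forall i, F i) -> F').
Variables (M : forall i, bimodType (G i) (F i)) (N : bimodType G' F').
Variable p : (forall i, M i) -> N.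
Hypotheses (uF : ultra_ring pF) (uM : ultra_bimod pG pF p).

Lemma ultra_lin_comb (d : nat) (e : forall i, 'I_d -> M i) (c : forall i, 'I_d -> F i) :
  p (fun i => \sum_k ract (e i k) (c i k)) =
  \sum_k ract (p (fun i => e i k)) (pF (fun i => c i k)).
Proof.
rewrite (ultra_sum (ultra_bimodD uM) (fun i k => ract (e i k) (c i k))).
by apply: eq_bigr => k _; rewrite (ultra_bimod_ract uM).
Qed.

Lemma ultra_lift_family (d : nat) (c : 'I_d -> F') :
  exists c' : forall i, 'I_d -> F i, forall k, pF (fun i => c' i k) = c k.
Proof.
have [c' c'P] := choice (fun k => (ultra_ring_quotient uF).1 (c k)).
by exists (fun i k => c' k i) => k; rewrite -c'P.
Qed.

(** The rank [d] is the same at all indices, so linear combinations of length [d] commute with the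
    projections, and independence and spanning hold because they hold on a set in [U]. *)
Lemma ultra_right_basis (d : nat) (e : forall i, 'I_d -> M i) :
  U [set i | right_basis (e i)] -> right_basis (fun k => p (fun i => e i k)).
Proof.
move=> eP; split=> [c c0 k|y].
  have [c' c'P] := ultra_lift_family c.
  have : p (fun i => \sum_k ract (e i k) (c' i k)) = p (fun _ => 0).
    rewrite (ultra_zero (ultra_bimodD uM)) -[RHS]c0 ultra_lin_comb; apply: eq_bigr => k' _.
    by rewrite c'P.
  move/(ultra_bimod_quotient uM).2 => ec0.
  rewrite -c'P -(ultra_zero (ultra_ringD uF)); apply/(ultra_ring_quotient uF).2.
  by apply: filterS2 _ eP ec0 => i [free_e _] e0 /=; exact: (free_e (c' i)).
have [x <-] := (ultra_bimod_quotient uM).1 y.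
have Hc i : exists c : 'I_d -> F i, right_basis (e i) -> x i = \sum_k ract (e i k) (c k).
  have [[_ e_span]|ne] := pselect (right_basis (e i)); last by exists (fun _ => 0).
  by have [c ->] := e_span (x i); exists c.
exists (fun k => pF (fun i => sval (cid (Hc i)) k)).
rewrite -ultra_lin_comb; apply/(ultra_bimod_quotient uM).2.
by apply: filterS _ eP => i ei; exact: (svalP (cid (Hc i)) ei).
Qed.

Lemma ultra_rdim (d : nat) : U [set i | has_rdim (M i) d] -> has_rdim N d.
Proof.
have [e eP] := ultra_basis_ex M d => Md; eexists; apply: ultra_right_basis.
by apply: filterS _ Md => i; exact: eP.
Qed.

(** A family of functionals acts componentwise on representatives. The constant finite dimension
    gives surjectivity: a functional on [N] is determined by its [d] values on a basis, and these
    values lift to every index. *)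
Lemma ultra_rdual (d : nat) : U [set i | has_rdim (M i) d] ->
  exists q : (forall i, rdual (M i)) -> rdual N, ultra_bimod pF pG q.
Proof.
move=> Md; have [rep repP] := choice (ultra_bimod_quotient uM).1.
pose ev (phi : forall i, rdual (M i)) (y : N) := pF (fun i => phi i (rep y i)).
have evE phi x : ev phi (p x) = pF (fun i => phi i (x i)).
  have /(ultra_bimod_quotient uM).2 repx := repP (p x).
  by apply/(ultra_ring_quotient uF).2; apply: filterS _ repx => i /= ->.
have ev_lin phi : ev phi \in @right_linear G' F' N.
  apply/right_linearP; split=> [y z|y f].
    rewrite -(repP y) -(repP z) -(ultra_bimodD uM) !evE -(ultra_ringD uF).
    by congr pF; apply: functional_extensionality_dep => i; rewrite rdualD.
  have [f' <-] := (ultra_ring_quotient uF).1 f.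
  rewrite -(repP y) -(ultra_bimod_ract uM) !evE -(ultra_ringM uF).
  by congr pF; apply: functional_extensionality_dep => i; rewrite rdualZ.
pose q phi := RDual (ev_lin phi).
have qE phi x : q phi (p x) = pF (fun i => phi i (x i)) := evE phi x.
have q_ext (phi : forall i, rdual (M i)) (chi : rdual N) :
    (forall x, pF (fun i => phi i (x i)) = chi (p x)) -> q phi = chi.
  by move=> phi_chi; apply: rdualP => y; rewrite -(repP y) qE.
exists q; split.
- split=> [chi|phi phi'].
    have [e eP] := ultra_basis_ex M d.
    have [a aP] := ultra_lift_family (fun k => chi (p (fun i => e i k))).
    have Hphi i : exists phi : rdual (M i),
        has_rdim (M i) d -> forall k, phi (e i k) = a i k.
      have [/eP ei|ni] := pselect (has_rdim (M i) d); last by exists 0.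
      by have [phi] := right_basis_rdual_ex ei (a i); exists phi.
    exists (fun i => sval (cid (Hphi i))).
    have e_basis : right_basis (fun k => p (fun i => e i k)).
      by apply: ultra_right_basis; apply: filterS _ Md => i; exact: eP.
    apply: (right_basis_rdual_inj e_basis) => k; rewrite qE -aP.
    apply/(ultra_ring_quotient uF).2; apply: filterS _ Md => i Mi.
    exact: (svalP (cid (Hphi i)) Mi).
  split=> [qphi|phi_phi']; last first.
    apply: q_ext => x; rewrite qE; apply/(ultra_ring_quotient uF).2.
    by apply: filterS _ phi_phi' => i /= ->.
  (* At each index [x] is taken to separate [phi i] from [phi' i] if they differ. Equality of the
     images at the class of these witnesses then forces [phi i = phi' i] on a set in [U]. *)
  have Hx i : exists x : M i, phi i x = phi' i x -> phi i = phi' i.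
    have [e|] := pselect (phi i = phi' i); first by exists 0.
    apply: contra_notP => /forallNP nx; apply: rdualP => x.
    by apply: contrapT => nxx; apply: (nx x) => /nxx.
  have : q phi (p (fun i => sval (cid (Hx i)))) = q phi' (p (fun i => sval (cid (Hx i)))).
    by rewrite qphi.
  rewrite !qE => /(ultra_ring_quotient uF).2; apply: filterS => i /= ex.
  exact: (svalP (cid (Hx i)) ex).
- by move=> phi phi'; apply: q_ext => x; rewrite rdual_addE !qE -(ultra_ringD uF).
- by move=> f phi; apply: q_ext => x; rewrite /= evE -(ultra_ringM uF).
- move=> phi g; apply: q_ext => x.
  by rewrite -[ract _ _]/(rdual_ract _ _) /= -(ultra_bimodZ uM) evE.
Qed.

End Bimodule.

(** By [ultra_rdual] the right dual of an ultraproduct is again an ultraproduct, so one inducts on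
    [k] with the rings exchanged and [d] shifted. *)
Lemma ultra_rdim_term (k : nat) (d : nat -> nat) (G F : I -> nzRingType) (G' F' : nzRingType)
    (pG : (forall i, G i) -> G') (pF : (forall i, F i) -> F')
    (M : forall i, bimodType (G i) (F i)) (N : bimodType G' F')
    (p : (forall i, M i) -> N) :
  ultra_ring pG -> ultra_ring pF -> ultra_bimod pG pF p ->
  (forall j, (j <= k)%N -> U [set i | has_rdim_term j (M i) (d j)]) ->
  has_rdim_term k N (d k).
Proof.
elim: k d G F G' F' pG pF M N p => [|k IH] d G F G' F' pG pF M N p uG uF uM dimM.
  exact: (ultra_rdim uF uM (dimM 0%N isT)).
have [q uq] := ultra_rdual uF uM (dimM 0%N isT).
apply: (IH (fun j => d j.+1) _ _ _ _ _ _ _ _ _ uF uG uq) => j jk.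
exact: (dimM j.+1).
Qed.

End Ultraproduct.

(** * Construction of the ultraproduct ring *)

Section UltraproductRing.
Local Open Scope classical_set_scope.
Variables (I : Type) (U : set_system I) (UU : UltraFilter U).

(* [UU] occurs in the type so that the instances below, which need an
   ultrafilter, can be inferred from it. *)
Record ultraproduct (V : UltraFilter U) (R : I -> unitRingType) : Type := Ultraproduct {
  ultra_class : set (forall i, R i);
  ultra_classP : exists x, ultra_class = [set y | U [set i | x i = y i]]
}.

Variable R : I -> unitRingType.
Local Notation S := (ultraproduct UU R).

Definition ultra_proj (x : forall i, R i) : S :=
  Ultraproduct UU (ex_intro _ x (erefl [set y | U [set i | x i = y i]])).

Lemma ultra_proj_quotient : ultra_quotient U ultra_proj.
Proof.
split=> [[A [x xA]]|x y].
  by exists x; rewrite /ultra_proj; case: _ / (esym xA) (ex_intro _ x xA) => ?; congr Ultraproduct.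
split=> [[xy]|xy].
  have : [set z | U [set i | y i = z i]] y by apply: filterS (@filterT _ U _).
  by rewrite -xy.
suff e : [set z | U [set i | x i = z i]] = [set z | U [set i | y i = z i]].
  rewrite /ultra_proj; move: (ex_intro _ x _) (ex_intro _ y _); rewrite e => ? ?.
  by congr Ultraproduct.
by apply/seteqP; split=> z /=; apply: filterS2 _ xy => i /= ->.
Qed.

Let projP x y := ultra_proj_quotient.2 x y.

Definition ultra_rep (u : S) : forall i, R i := sval (cid (ultra_proj_quotient.1 u)).

Lemma ultra_repK u : ultra_proj (ultra_rep u) = u.
Proof. exact: svalP (cid (ultra_proj_quotient.1 u)). Qed.

Lemma ultra_rep_proj x : U [set i | ultra_rep (ultra_proj x) i = x i].
Proof. by apply/projP; rewrite ultra_repK. Qed.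

HB.instance Definition _ := gen_eqMixin S.
HB.instance Definition _ := gen_choiceMixin S.

Definition ultra_add (u v : S) : S := ultra_proj (fun i => ultra_rep u i + ultra_rep v i).
Definition ultra_opp (u : S) : S := ultra_proj (fun i => - ultra_rep u i).
Definition ultra_mul (u v : S) : S := ultra_proj (fun i => ultra_rep u i * ultra_rep v i).

Lemma ultra_addE x y : ultra_add (ultra_proj x) (ultra_proj y) = ultra_proj (fun i => x i + y i).
Proof.
apply/projP; apply: filterS2 _ (ultra_rep_proj x) (ultra_rep_proj y) => i /=.
by move=> -> ->.
Qed.

Lemma ultra_oppE x : ultra_opp (ultra_proj x) = ultra_proj (fun i => - x i).
Proof. by apply/projP; apply: filterS _ (ultra_rep_proj x) => i /= ->. Qed.

Lemma ultra_mulE x y : ultra_mul (ultra_proj x) (ultra_proj y) = ultra_proj (fun i => x i * y i).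
Proof.
apply/projP; apply: filterS2 _ (ultra_rep_proj x) (ultra_rep_proj y) => i /=.
by move=> -> ->.
Qed.

Let projE := (ultra_addE, ultra_oppE, ultra_mulE).

Lemma ultra_proj_ext x y : (forall i, x i = y i) -> ultra_proj x = ultra_proj y.
Proof. by move=> xy; apply/projP; apply: filterS _ (@filterT _ U _) => i _; apply: xy. Qed.

Fact ultra_addA : associative ultra_add.
Proof.
move=> u v w; rewrite -(ultra_repK u) -(ultra_repK v) -(ultra_repK w) !projE.
by apply: ultra_proj_ext => i; rewrite addrA.
Qed.

Fact ultra_addC : commutative ultra_add.
Proof. by move=> u v; apply: ultra_proj_ext => i; rewrite addrC. Qed.

Fact ultra_add0 : left_id (ultra_proj (fun _ => 0)) ultra_add.
Proof.
by move=> u; rewrite -(ultra_repK u) projE; apply: ultra_proj_ext => i; rewrite add0r.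
Qed.

Fact ultra_addN : left_inverse (ultra_proj (fun _ => 0)) ultra_opp ultra_add.
Proof.
by move=> u; rewrite -(ultra_repK u) !projE; apply: ultra_proj_ext => i; rewrite addNr.
Qed.

HB.instance Definition _ := GRing.isZmodule.Build S ultra_addA ultra_addC ultra_add0 ultra_addN.

Lemma ultra_projN x : ultra_proj (fun i => - x i) = - ultra_proj x.
Proof. exact/esym/ultra_oppE. Qed.

Fact ultra_mulA : associative ultra_mul.
Proof.
move=> u v w; rewrite -(ultra_repK u) -(ultra_repK v) -(ultra_repK w) !projE.
by apply: ultra_proj_ext => i; rewrite mulrA.
Qed.

Fact ultra_mul1l : left_id (ultra_proj (fun _ => 1)) ultra_mul.
Proof.
by move=> u; rewrite -(ultra_repK u) projE; apply: ultra_proj_ext => i; rewrite mul1r.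
Qed.

Fact ultra_mul1r : right_id (ultra_proj (fun _ => 1)) ultra_mul.
Proof.
by move=> u; rewrite -(ultra_repK u) projE; apply: ultra_proj_ext => i; rewrite mulr1.
Qed.

Fact ultra_mulDl : left_distributive ultra_mul ultra_add.
Proof.
move=> u v w; rewrite -(ultra_repK u) -(ultra_repK v) -(ultra_repK w) !projE.
by apply: ultra_proj_ext => i; rewrite mulrDl.
Qed.

Fact ultra_mulDr : right_distributive ultra_mul ultra_add.
Proof.
move=> u v w; rewrite -(ultra_repK u) -(ultra_repK v) -(ultra_repK w) !projE.
by apply: ultra_proj_ext => i; rewrite mulrDr.
Qed.

Fact ultra_one_neq0 : ultra_proj (fun _ => 1) != 0.
Proof.
apply/eqP => /projP; suff -> : [set i | (1 : R i) = 0] = set0 by exact: filter_not_empty.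
by apply/seteqP; split=> i //= /eqP; rewrite oner_eq0.
Qed.

HB.instance Definition _ := GRing.Zmodule_isNzRing.Build S
  ultra_mulA ultra_mul1l ultra_mul1r ultra_mulDl ultra_mulDr ultra_one_neq0.

(** Invertibility is taken in the ultraproduct itself, which makes it a [unitRingType] for arbitrary
    [R i]; non-units are their own [ultra_inv]. *)
Definition ultra_unit : pred S := fun u => `[< exists v, v * u = 1 /\ u * v = 1 >].
Definition ultra_inv (u : S) : S :=
  if pselect (exists v, v * u = 1 /\ u * v = 1) is left e then sval (cid e) else u.

Fact ultra_mulVr : {in ultra_unit, left_inverse 1 ultra_inv *%R}.
Proof.
move=> u /asboolP uu; rewrite /ultra_inv; case: pselect => // e.
by have [] := svalP (cid e).
Qed.

Fact ultra_divrr : {in ultra_unit, right_inverse 1 ultra_inv *%R}.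
Proof.
move=> u /asboolP uu; rewrite /ultra_inv; case: pselect => // e.
by have [] := svalP (cid e).
Qed.

Fact ultra_unitP u v : v * u = 1 /\ u * v = 1 -> ultra_unit u.
Proof. by move=> uv; apply/asboolP; exists v. Qed.

Fact ultra_inv_out : {in [predC ultra_unit], ultra_inv =1 id}.
Proof. by move=> u /asboolPn nu; rewrite /ultra_inv; case: pselect. Qed.

HB.instance Definition _ := GRing.NzRing_hasMulInverse.Build S
  ultra_mulVr ultra_divrr ultra_unitP ultra_inv_out.

Lemma ultra_proj_ring : ultra_ring U ultra_proj.
Proof.
split; first exact: ultra_proj_quotient.
- by move=> x y; exact/esym/ultra_addE.
- by move=> x y; exact/esym/ultra_mulE.
- by [].
Qed.

Lemma ultraproduct_division_ring :
  (forall i, division_ring (R i)) -> division_ring (ultraproduct UU R).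
Proof.
move=> divR u; rewrite -(ultra_repK u); move: (ultra_rep u) => x x0.
have {}x0 : U [set i | x i \is a GRing.unit].
  (* Maximality of [U]: either the zero set of [x] or its complement belongs to [U], and the former
     would make the class of [x] zero. *)
  have [x_eq0|] := in_ultra_setVsetC [set i | x i = 0] UU.
    by case/eqP: x0; apply/projP.
  by apply: filterS => i /= /eqP; exact: divR.
apply/asboolP; exists (ultra_proj (fun i => (x i)^-1)).
split; rewrite -(ultra_ringM ultra_proj_ring); apply/projP.
  by apply: filterS _ x0 => i; exact: mulVr.
by apply: filterS _ x0 => i; exact: divrr.
Qed.

End UltraproductRing.

(** * Ultraproducts of division ring extensions *)

Section UltraproductExtension.
Local Open Scope classical_set_scope.
Variables (I : Type) (U : set_system I) (UU : UltraFilter U).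
Variables (G F : I -> unitRingType) (iota : forall i, {rmorphism G i -> F i}).

Local Notation pG := (@ultra_proj I U UU G).
Local Notation pF := (@ultra_proj I U UU F).

Definition ultra_map (u : ultraproduct UU G) : ultraproduct UU F :=
  pF (fun i => iota i (ultra_rep u i)).

Lemma ultra_mapE x : ultra_map (pG x) = pF (fun i => iota i (x i)).
Proof.
apply/(ultra_proj_quotient UU F).2.
by apply: filterS _ (ultra_rep_proj UU x) => i /= ->.
Qed.

Fact ultra_map_is_zmod_morphism : zmod_morphism ultra_map.
Proof.
move=> u v; rewrite -(ultra_repK u) -(ultra_repK v).
rewrite -ultra_projN -(ultra_ringD (ultra_proj_ring UU G)) !ultra_mapE.
rewrite -ultra_projN -(ultra_ringD (ultra_proj_ring UU F)).
by apply: ultra_proj_ext => i; rewrite rmorphB.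
Qed.

Fact ultra_map_is_monoid_morphism : monoid_morphism ultra_map.
Proof.
split=> [|u v].
  by rewrite ultra_mapE; apply: ultra_proj_ext => i; rewrite rmorph1.
rewrite -(ultra_repK u) -(ultra_repK v).
rewrite -(ultra_ringM (ultra_proj_ring UU G)) !ultra_mapE.
rewrite -(ultra_ringM (ultra_proj_ring UU F)).
by apply: ultra_proj_ext => i; rewrite rmorphM.
Qed.

HB.instance Definition _ :=
  GRing.isZmodMorphism.Build _ _ ultra_map ultra_map_is_zmod_morphism.
HB.instance Definition _ :=
  GRing.isMonoidMorphism.Build _ _ ultra_map ultra_map_is_monoid_morphism.

Lemma ultra_map_extension :
  (forall i, division_ring_extension (iota i)) -> division_ring_extension ultra_map.
Proof.
move=> ext; split.
- by apply: ultraproduct_division_ring => i; have [] := ext i.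
- by apply: ultraproduct_division_ring => i; have [] := ext i.
- suff : injective (ultra_map : ultraproduct UU G -> ultraproduct UU F) by [].
  move=> u v; rewrite -(ultra_repK u) -(ultra_repK v) !ultra_mapE.
  move=> /(ultra_proj_quotient UU F).2 uv; apply/(ultra_proj_quotient UU G).2.
  by apply: filterS _ uv => i; have [_ _] := ext i; apply.
Qed.

(** The carrier of [ext_bimod] is the larger ring, so [pF] serves both as ring projection and as
    bimodule projection. *)
Lemma ultra_map_bimod :
  ultra_bimod U pG pF (M := fun i => ext_bimod (iota i)) (N := ext_bimod ultra_map) pF.
Proof.
split.
- exact: ultra_proj_quotient.
- exact: (ultra_ringD (ultra_proj_ring UU F)).
- move=> g x; rewrite -[RHS]/(ultra_map (pG g) * pF x) ultra_mapE.
  exact: (ultra_ringM (ultra_proj_ring UU F)).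
- exact: (ultra_ringM (ultra_proj_ring UU F)).
Qed.

End UltraproductExtension.
Arguments ultra_map {I U} UU {G F} iota u.

(** * From long initial segments to the full sequence *)

Lemma periodic_seq_12n (n k : nat) : (k < n)%N ->
  periodic_seq (1%N :: nseq n.-1 2%N ++ [:: 1%N; n]) k = if k == 0%N then 1%N else 2%N.
Proof.
(* The period has length [n + 2 > k], so no reduction takes place, and its first [n] entries are 1
   followed by [n - 1] twos. *)
move=> kn; rewrite /periodic_seq modn_small; last by rewrite /= size_cat size_nseq /=; lia.
case: k kn => //= k kn; rewrite nth_cat size_nseq.
have kn1 : (k < n.-1)%N by lia.
by rewrite kn1 nth_nseq kn1.
Qed.

Lemma infinite_nat_unbounded (A : set nat) (i : nat) :
  infinite_set A -> exists n, A n /\ (i <= n)%N.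
Proof.
move=> infA; apply: contrapT => /forallNP bounded; apply: infA.
apply: (sub_finite_set (B := `I_i%classic)) (finite_II i) => n An /=.
by rewrite ltnNge; apply/negP => ni; apply: (bounded n).
Qed.

Theorem theorem1p5 :
  infinite_set [set n : nat | (2 <= n)%N /\
    exists (G F : unitRingType) (iota : {rmorphism G -> F}),
      division_ring_extension iota /\
      has_rdim_seq (ext_bimod iota)
        (periodic_seq (1%N :: nseq n.-1 2%N ++ [:: 1%N; n]))]%classic ->
  exists (G F : unitRingType) (iota : {rmorphism G -> F}),
    squared_small_counterexample iota.
Proof.
move=> infS.
(* Some admissible [n >= i] gives an extension whose first [i] dimensions are as wanted. The sigma
   type packs both rings and the morphism, so that [choice] applies to a single object. *)
have ext_ex (i : nat) : exists E : {G : unitRingType & {F : unitRingType & {rmorphism G -> F}}},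
    division_ring_extension (projT2 (projT2 E)) /\
    forall k, (k < i)%N ->
      has_rdim_term k (ext_bimod (projT2 (projT2 E))) (if k == 0%N then 1%N else 2%N).
  have [n [[_ [G [F [iota [ext dimF]]]]] ni]] :=
    infinite_nat_unbounded i infS.
  exists (existT _ G (existT _ F iota)); split=> //= k ki.
  by rewrite -(periodic_seq_12n (n := n)); [exact: dimF | lia].
have [E EP] := choice ext_ex.
(* An ultrafilter refining the filter of cofinite sets contains every tail of the indices. *)
have [U [UU coU]] := @ultraFilterLemma nat \oo%classic _.
pose iota i := projT2 (projT2 (E i)).
pose G i := projT1 (E i); pose F i := projT1 (projT2 (E i)).
have ext : division_ring_extension (ultra_map UU iota).
  by apply: ultra_map_extension => i; exact: (EP i).1.
have dimF : has_rdim_seq (ext_bimod (ultra_map UU iota))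
    (fun k => if k == 0%N then 1%N else 2%N).
  move=> k.
  apply: (ultra_rdim_term (d := fun j => if j == 0%N then 1%N else 2%N)
            (ultra_proj_ring UU G) (ultra_proj_ring UU F) (ultra_map_bimod UU iota)).
  (* The [j]-th term is correct at every index [i > j], hence for all [j <= k] on the tail starting
     at [k + 1]. *)
  move=> j jk; apply: coU; exists k.+1 => // i ki.
  by apply: (EP i).2; rewrite /= in ki; lia.
exists (ultraproduct UU G), (ultraproduct UU F), (ultra_map UU iota : {rmorphism _ -> _}).
split=> //; have [divG divF _] := ext.
exact: infinite_ldim_of_rdim_1222.
Qed.
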